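(* Let $p,q\ge 0$ be integers and $n=p+q$. (1) If $1\le i\le p$ and $p+1\le j\le p+q$, then every hyperbolic Givens matrix $H_{ij}$ belongs to $SO^{+}(p,q)$. (2) If $i\neq j$ and either $1\le i,j\le p$ or $p+1\le i,j\le p+q$, then every standard Givens matrix $R_{ij}$ belongs to $SO^{+}(p,q)$.
   Context: $I_{p,q}=I_p\oplus(-I_q)$; $SO(p,q)=\{X\in M(n,\mathbf{R}): X^TI_{p,q}X=I_{p,q},\ \det X=1\}$, and $SO^{+}(p,q)$ is the connected component of the identity in $SO(p,q)$. For $i<j$, a hyperbolic Givens matrix $H_{ij}$ is an $n\times n$ real matrix equal to the identity except in the principal submatrix on rows and columns $(i,j)$, where it equals $\begin{pmatrix} a& b\\ b& a\end{pmatrix}$ with $a=\cosh\theta$, $b=\sinh\theta$ for some $\theta\in\mathbf{R}$ (equivalently $a^2-b^2=1$, $a>0$). For $i\ne j$, a standard Givens matrix $R_{ij}$ is an $n\times n$ real matrix equal to the identity except in the principal submatrix on rows and columns $(i,j)$ (in that order), where it equals $\begin{pmatrix} c& -s\\ s& c\end{pmatrix}$ with $c,s\in\mathbf{R}$, $c^2+s^2=1$. *)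

(* Defs.v *)
From HB Require Import structures.
From mathcomp Require Import all_boot all_order all_algebra.
From mathcomp Require Import all_classical all_reals all_analysis.
Set Implicit Arguments.
Unset Strict Implicit.
Unset Printing Implicit Defensive.
Import Order.TTheory GRing.Theory Num.Theory.
Import numFieldNormedType.Exports.
Local Open Scope classical_set_scope.
Local Open Scope ring_scope.

Definition cosh (R : realType) (t : R) : R := (expR t + expR (- t)) / 2.
Definition sinh (R : realType) (t : R) : R := (expR t - expR (- t)) / 2.

Definition Ipq (R : realType) (p q : nat) : 'M[R]_(p + q) :=
  block_mx 1%:M 0 0 (- 1%:M).

Definition SO (R : realType) (p q : nat) : set 'M[R]_(p + q) :=
  [set X | X^T *m Ipq R p q *m X = Ipq R p q /\ \det X = 1].
Arguments SO : clear implicits.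

(* The topology is the entrywise one carried by 'M[R]_(p + q). *)
Definition SOplus (R : realType) (p q : nat) : set 'M[R]_(p + q) :=
  connected_component (SO R p q) 1%:M.
Arguments SOplus : clear implicits.

(* The identity matrix, except that the principal submatrix on rows and columns
   (i, j), in that order, is [a b; c d]; meaningful for i != j. *)
Definition plane_mx (R : realType) (n : nat) (i j : 'I_n) (a b c d : R) :
    'M[R]_n :=
  \matrix_(k, l)
    if (k == i) && (l == i) then a
    else if (k == i) && (l == j) then b
    else if (k == j) && (l == i) then c
    else if (k == j) && (l == j) then d
    else (k == l)%:R.

Definition hyperbolic_givens (R : realType) (n : nat) (i j : 'I_n) :
    set 'M[R]_n :=
  [set H | (i < j)%N /\ exists t : R,
     H = plane_mx i j (cosh t) (sinh t) (sinh t) (cosh t)].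

Definition standard_givens (R : realType) (n : nat) (i j : 'I_n) :
    set 'M[R]_n :=
  [set G | i != j /\ exists c s : R,
     c ^+ 2 + s ^+ 2 = 1 /\ G = plane_mx i j c (- s) s c].
Arguments hyperbolic_givens R {n} i j.
Arguments standard_givens R {n} i j.

(* Main.v *)
(* Both families of Givens matrices are continuous one-parameter groups
   [t |-> g t] of matrices preserving [Ipq].  Such matrices have determinant
   [1] or [-1], and [g t] is the square of [g (t / 2)], so its determinant is
   [1]; the image of the real line under [g] is then a connected subset of
   [SO p q] that contains the identity. *)
Require Import Defs.
From HB Require Import structures.
From mathcomp Require Import all_boot all_order all_algebra.
From mathcomp Require Import all_classical all_reals all_analysis.
From mathcomp Require Import ring lra.
Import Order.TTheory GRing.Theory Num.Theory.
Import numFieldNormedType.Exports.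
Local Open Scope classical_set_scope.
Local Open Scope ring_scope.

(** A neighbourhood of a matrix contains a box of entrywise neighbourhoods; there are finitely many
    entries, so their preimages intersect in a neighbourhood. *)
Lemma continuous_mx {T : topologicalType} {U : topologicalType} {m n : nat}
    (f : T -> 'M[U]_(m, n)) :
  (forall i j, continuous (fun x => f x i j)) -> continuous f.
Proof.
move=> cf x A [P Pfx sPA]; rewrite /= nbhs_filterE.
have : \forall y \near x, forall i j, P i j (f y i j).
  by apply: filter_forall => i; apply: filter_forall => j; exact: (cf i j x).
by apply: filterS => y Py; exact: sPA.
Qed.

Section PlaneMatrices.
Context {R : realType} {n : nat} {i j : 'I_n}.
Hypothesis neq_ij : i != j.

Let ij : (i == j) = false. Proof. exact/negbTE. Qed.
Let ji : (j == i) = false. Proof. by rewrite eq_sym. Qed.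

Lemma plane_mx1 : plane_mx i j 1 0 0 1 = 1%:M :> 'M[R]_n.
Proof.
apply/matrixP => k l; rewrite !mxE.
by do 4?[case: ifP => [/andP[/eqP-> /eqP->]|_]]; rewrite ?eqxx ?ij ?ji.
Qed.

Lemma mul_plane_mx (a b c d : R) (M : 'M[R]_n) k l :
  (plane_mx i j a b c d *m M) k l =
  if k == i then a * M i l + b * M j l
  else if k == j then c * M i l + d * M j l
  else M k l.
Proof.
(* The terms [i] and [j] of the sum are isolated. The others vanish, except the diagonal one when
   [k] is neither [i] nor [j]. *)
rewrite mxE (bigD1 i) //= (bigD1 j) ?ji //= !mxE !eqxx ij ji !andbT !andbF /=.
have [->|ki] := eqVneq k i.
  rewrite /= big1 ?addr0 // => m /andP[mi mj].
  by rewrite mxE eqxx (negbTE mi) (negbTE mj) ij eq_sym (negbTE mi) mul0r.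
have [->|kj] := eqVneq k j.
  rewrite /= big1 ?addr0 // => m /andP[mi mj].
  by rewrite mxE eqxx (negbTE mi) (negbTE mj) ji eq_sym (negbTE mj) mul0r.
rewrite /= !mul0r !add0r (bigD1 k) /= ?ki // mxE.
rewrite (negbTE ki) (negbTE kj) eqxx mul1r.
rewrite big1 ?addr0 // => m /andP[_ mk].
by rewrite mxE (negbTE ki) (negbTE kj) [k == m]eq_sym (negbTE mk) mul0r.
Qed.

Lemma plane_mxM (a b c d a' b' c' d' : R) :
  plane_mx i j a b c d *m plane_mx i j a' b' c' d' =
  plane_mx i j (a * a' + b * c') (a * b' + b * d')
               (c * a' + d * c') (c * b' + d * d').
Proof.
apply/matrixP => k l; rewrite mul_plane_mx !mxE !eqxx ij ji /=.
case: (eqVneq l i) => [->|li]; [|case: (eqVneq l j) => [->|lj]].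
- by case: eqP => // _; case: eqP.
- by case: eqP => // _; case: eqP.
rewrite !andbF !mulr0 addr0.
case: (eqVneq k i) => [->|_]; first by rewrite eq_sym (negbTE li).
by case: (eqVneq k j) => [->|//]; rewrite eq_sym (negbTE lj).
Qed.

Lemma tr_plane_mx (a b c d : R) :
  (plane_mx i j a b c d)^T = plane_mx i j a c b d.
Proof.
apply/matrixP => k l; rewrite !mxE.
rewrite ![_ && (k == _)]andbC [l == k]eq_sym.
by case: (eqVneq k i) => [->|_] //=; rewrite ij.
Qed.

Lemma plane_mx_continuous (a b c d : R -> R) :
  continuous a -> continuous b -> continuous c -> continuous d ->
  continuous (fun t => plane_mx i j (a t) (b t) (c t) (d t)).
Proof.
move=> ca cb cc cd; apply: continuous_mx => k l.
rewrite (_ : (fun t => _) = if (k == i) && (l == i) then a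
    else if (k == i) && (l == j) then b
    else if (k == j) && (l == i) then c
    else if (k == j) && (l == j) then d
    else cst (k == l)%:R).
  by do ?case: ifP => _ //; move=> x; exact: cvg_cst.
by apply/funext => t; rewrite mxE; do ?case: ifP.
Qed.

End PlaneMatrices.

Section Signature.
Context {R : realType} {p q : nat}.

(** Indices start at 0, so the boolean [p <= k], read as an exponent, marks the last [q]
    coordinates. *)
Definition Ipq_sign (k : 'I_(p + q)) : R := (-1) ^+ (p <= k)%N.

Lemma Ipq_diag : Ipq R p q = diag_mx (\row_k Ipq_sign k).
Proof.
rewrite /Ipq (_ : \row_k _ = row_mx (const_mx 1) (const_mx (-1))).
  by rewrite diag_mx_row !diag_const_mx raddfN.
apply/rowP => k; rewrite mxE /Ipq_sign; case: (split_ordP k) => m ->.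
  by rewrite row_mxEl mxE /= leqNgt ltn_ord.
by rewrite row_mxEr mxE /= leq_addr.
Qed.

Lemma Ipq_signM k : Ipq_sign k * Ipq_sign k = 1.
Proof. by rewrite -expr2 sqrr_sign. Qed.

(** Conjugation by a diagonal sign matrix multiplies entry [(k, l)] by the signs of [k] and [l].
    Diagonal entries are unchanged, and [b] and [c] change sign exactly when [i] and [j] lie in
    different blocks. *)
Lemma mul_Ipq_plane_mx (i j : 'I_(p + q)) (a b c d : R) :
  Ipq R p q *m plane_mx i j a b c d =
  plane_mx i j a (Ipq_sign i * Ipq_sign j * b) (Ipq_sign i * Ipq_sign j * c) d
    *m Ipq R p q.
Proof.
rewrite Ipq_diag mul_diag_mx mul_mx_diag; apply/matrixP => k l; rewrite !mxE.
case: ifP => [/andP[/eqP-> /eqP->]|_]; first by rewrite mulrC.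
case: ifP => [/andP[/eqP-> /eqP->]|_].
  by rewrite [RHS]mulrAC -(mulrA (Ipq_sign i)) Ipq_signM mulr1.
case: ifP => [/andP[/eqP-> /eqP->]|_].
  by rewrite [RHS]mulrAC [Ipq_sign i * _ * _]mulrAC Ipq_signM mul1r.
case: ifP => [/andP[/eqP-> /eqP->]|_]; first by rewrite mulrC.
by case: eqP => [->|_]; rewrite ?mulr1 ?mul1r ?mulr0 ?mul0r.
Qed.

Lemma preserves_Ipq_sqr_det (X : 'M[R]_(p + q)) :
  X^T *m Ipq R p q *m X = Ipq R p q -> \det X ^+ 2 = 1.
Proof.
have detI : \det (Ipq R p q) != 0.
  by rewrite Ipq_diag det_diag; apply/prodf_neq0 => k _; rewrite mxE signr_eq0.
move=> /(congr1 determinant); rewrite !det_mulmx det_tr => detX.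
by apply: (mulfI detI); rewrite mulr1 -[RHS]detX; ring.
Qed.

Lemma one_parameter_group_SOplus (g : R -> 'M[R]_(p + q)) :
  continuous g -> g 0 = 1%:M -> (forall s t, g (s + t) = g s *m g t) ->
  (forall t, (g t)^T *m Ipq R p q *m g t = Ipq R p q) ->
  forall t, SOplus R p q (g t).
Proof.
(* The component is the union of the connected subsets of [SO R p q] containing [1%:M]; the image of
   [g] is one of them. *)
move=> cg g0 gD gI t; exists (range g); last by exists t.
split; first by exists 0.
- move=> _ [s _ <-]; split => //.
  by rewrite [s]splitr gD det_mulmx -expr2 preserves_Ipq_sqr_det.
- apply: connected_continuous_connected; first exact/connected_intervalP.
  exact: continuous_subspaceT.
Qed.

End Signature.

Section CoshSinh.
Context {R : realType}.

Lemma cosh0 : cosh 0 = 1 :> R.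
Proof. by rewrite /cosh oppr0 expR0; field. Qed.

Lemma sinh0 : sinh 0 = 0 :> R.
Proof. by rewrite /sinh oppr0 subrr mul0r. Qed.

Lemma coshD (s t : R) : cosh (s + t) = cosh s * cosh t + sinh s * sinh t.
Proof. by rewrite /cosh /sinh opprD !expRD; field. Qed.

Lemma sinhD (s t : R) : sinh (s + t) = sinh s * cosh t + cosh s * sinh t.
Proof. by rewrite /cosh /sinh opprD !expRD; field. Qed.

(** The left side factors as [expR t * expR (- t)]. *)
Lemma cosh2Bsinh2 (t : R) : cosh t ^+ 2 - sinh t ^+ 2 = 1.
Proof. by rewrite -[RHS](expRxMexpNx_1 t) /cosh /sinh; field. Qed.

Lemma continuous_cosh : continuous (@cosh R).
Proof.
move=> t; apply: cvgM; last exact: cvg_cst.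
apply: cvgD; first exact: continuous_expR.
by apply: continuous_comp; [exact: opp_continuous | exact: continuous_expR].
Qed.

Lemma continuous_sinh : continuous (@sinh R).
Proof.
move=> t; apply: cvgM; last exact: cvg_cst.
apply: cvgB; first exact: continuous_expR.
by apply: continuous_comp; [exact: opp_continuous | exact: continuous_expR].
Qed.

End CoshSinh.

(** This supplies the angle that places a standard Givens matrix in a one-parameter group. The sine
    of [acos c] is [|s|], so [acos c] serves when [0 <= s] and its opposite otherwise. *)
Lemma cos_sin_surj {R : realType} (c s : R) :
  c ^+ 2 + s ^+ 2 = 1 -> exists t, c = cos t /\ s = sin t.
Proof.
move=> cs1.
have c1 : -1 <= c <= 1.
  rewrite -ler_norml -(@ler_pXn2r _ 2) ?nnegrE // real_normK ?num_real //.
  by rewrite expr1n; nra.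
have ss : Num.sqrt (1 - c ^+ 2) = `|s| by rewrite -cs1 addrC addKr sqrtr_sqr.
have [s0|s0] := leP 0 s.
  by exists (acos c); rewrite acosK ?in_itv //= sin_acos // ss ger0_norm.
exists (- acos c); rewrite cosN sinN acosK ?in_itv //= sin_acos // ss.
by rewrite ltr0_norm // opprK.
Qed.

Theorem proposition19 (R : realType) (p q : nat) :
  (forall i j : 'I_(p + q), (i < p)%N -> (p <= j)%N ->
     forall H : 'M[R]_(p + q),
       hyperbolic_givens R i j H -> SOplus R p q H) /\
  (forall i j : 'I_(p + q), i != j ->
     ((i < p)%N /\ (j < p)%N) \/ ((p <= i)%N /\ (p <= j)%N) ->
     forall G : 'M[R]_(p + q),
       standard_givens R i j G -> SOplus R p q G).
Proof.
split=> [i j ip pj H [ltij [t ->]]|i j neq_ij ijpq G [_ [c [s [cs1 ->]]]]].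
  have neq_ij : i != j by rewrite -val_eqE ltn_eqF.
  have signE : Ipq_sign i * Ipq_sign j = -1 :> R.
    by rewrite /Ipq_sign leqNgt ip pj mul1r.
  pose g (u : R) := plane_mx i j (cosh u) (sinh u) (sinh u) (cosh u).
  apply: (@one_parameter_group_SOplus _ _ _ g).
  - by apply: plane_mx_continuous;
      first [exact: continuous_cosh | exact: continuous_sinh].
  - by rewrite /g cosh0 sinh0 plane_mx1.
  - by move=> u v; rewrite /g plane_mxM // coshD sinhD; congr plane_mx; ring.
  (* Here [g u] is symmetric, and moving [Ipq] past it negates the off-diagonal entries, giving
     [g (- u)]. It remains to see that [g u *m g (- u)] is the identity, written as a plane matrix
     with [1] expanded as [cosh u ^+ 2 - sinh u ^+ 2]. *)
  - move=> u; rewrite -mulmxA mul_Ipq_plane_mx tr_plane_mx // mulmxA.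
    rewrite plane_mxM // signE !mulN1r -[RHS]mul1mx -(plane_mx1 neq_ij) -(cosh2Bsinh2 u).
    by congr (plane_mx _ _ _ _ _ _ *m _); ring.
have [t [-> ->]] := cos_sin_surj _ _ cs1.
have signE : Ipq_sign i * Ipq_sign j = 1 :> R.
  rewrite /Ipq_sign; case: ijpq => [[ip jp]|[pi pj]];
    last by rewrite pi pj mulrNN mulr1.
  by rewrite !(leqNgt p) ip jp mulr1.
pose g (u : R) := plane_mx i j (cos u) (- sin u) (sin u) (cos u).
apply: (@one_parameter_group_SOplus _ _ _ g).
- apply: plane_mx_continuous; try exact: continuous_cos;
    last exact: continuous_sin.
  by move=> u; apply: cvgN; exact: continuous_sin.
- by rewrite /g cos0 sin0 oppr0 plane_mx1.
- by move=> u v; rewrite /g plane_mxM // cosD sinD; congr plane_mx; ring.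
(* Within one block [Ipq] commutes with [g u], so the claim reduces to the orthogonality of a plane
   rotation. *)
- move=> u; rewrite -mulmxA mul_Ipq_plane_mx tr_plane_mx // mulmxA.
  rewrite plane_mxM // signE !mul1r -[RHS]mul1mx -(plane_mx1 neq_ij) -(cos2Dsin2 u).
  by congr (plane_mx _ _ _ _ _ _ *m _); ring.
Qed.
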